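(* Let $\mathbb{C}$ be a category and $\mathcal{N}$ an ideal in $\mathbb{C}$ such that $\mathbb{C}$ has weak $\mathcal{N}$-kernels (of all morphisms) and weak kernel pairs (of all morphisms). Then the following conditions are equivalent: (a) For every reflexive graph in $\mathbb{C}$, i.e. objects $G_1,G_0$ and morphisms $d,c:G_1\to G_0$, $e:G_0\to G_1$ with $de=ce=1_{G_0}$, the ordered pair $(d,c)$ satisfies $(\ast\pi_0)$. (b) Every weak kernel pair in $\mathbb{C}$ satisfies $(\ast\pi_0)$. Moreover, when kernel pairs exist in $\mathbb{C}$, these conditions are also equivalent to each of the following ones: (c) Every reflexive relation in $\mathbb{C}$ satisfies $(\ast\pi_0)$. (d) Every kernel pair in $\mathbb{C}$ satisfies $(\ast\pi_0)$.
   Context: An ideal in a category $\mathbb{C}$ is a class $\mathcal{N}$ of morphisms such that whenever $fgh$ is a composite of three morphisms with $g\in\mathcal{N}$, then $fgh\in\mathcal{N}$. A pair $(\mathbb{C},\mathcal{N})$ with $\mathcal{N}$ an ideal of $\mathbb{C}$ is called a multi-pointed category. A weak $\mathcal{N}$-kernel of a morphism $f:X\to Y$ is a morphism $k:K\to X$ such that $fk\in\mathcal{N}$ and, for every $k':K'\to X$ with $fk'\in\mathcal{N}$, there exists a (not necessarily unique) morphism $u:K'\to K$ with $k'=ku$. A weak $\mathcal{N}$-star of an ordered pair $(f_1,f_2)$ of parallel morphisms is a pair $(f_1k,f_2k)$ where $k$ is a weak $\mathcal{N}$-kernel of $f_1$. Condition $(\ast\pi_0)$ on an ordered pair $(f_1,f_2)$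 of parallel morphisms $f_1,f_2:X\to Y$: for a weak $\mathcal{N}$-star $(f_1k,f_2k)$ of $(f_1,f_2)$ and for any morphism $g:Y\to Z$, one has $gf_1k=gf_2k \Leftrightarrow gf_1=gf_2$. (When a weak $\mathcal{N}$-star exists, requiring this for one weak $\mathcal{N}$-star is equivalent to requiring it for all of them.) A weak kernel pair of $f:X\to Y$ is a pair $(u,v)$ of morphisms $u,v:P\to X$ with $fu=fv$ such that for any $u',v':P'\to X$ with $fu'=fv'$ there exists a (not necessarily unique) $w:P'\to P$ with $uw=u'$, $vw=v'$. A kernel pair is the same with $w$ unique. A reflexive relation is a reflexive graph $(d,c,e)$ with $d,c$ jointly monomorphic. Kernel pairs, weak kernel pairs and reflexive relations are regarded as ordered pairs of parallel morphisms. *)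

(* Defs.v *)
Set Implicit Arguments.
Unset Strict Implicit.
Unset Printing Implicit Defensive.

Declare Scope cat_scope.
Delimit Scope cat_scope with cat.
Local Open Scope cat_scope.

Record category := Category {
  obj :> Type;
  hom : obj -> obj -> Type;
  idm : forall X : obj, hom X X;
  comp : forall X Y Z : obj, hom Y Z -> hom X Y -> hom X Z;
  comp_idl : forall (X Y : obj) (f : hom X Y), comp (idm Y) f = f;
  comp_idr : forall (X Y : obj) (f : hom X Y), comp f (idm X) = f;
  comp_assoc : forall (W X Y Z : obj)
      (f : hom Y Z) (g : hom X Y) (h : hom W X),
    comp f (comp g h) = comp (comp f g) h
}.

Arguments hom {c} X Y.
Arguments idm {c} X.
Arguments comp {c X Y Z} f g.

Notation "f \o g" := (comp f g)
  (at level 50, left associativity) : cat_scope.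

Definition morphism_class (C : category) : Type :=
  forall X Y : C, hom X Y -> Prop.

Section Notions.
Variables (C : category) (N : morphism_class C).

Definition is_ideal : Prop :=
  forall (W X Y Z : C) (f : hom Y Z) (g : hom X Y) (h : hom W X),
    N g -> N (f \o g \o h).

Definition is_weak_kernel (X Y : C) (f : hom X Y) (K : C) (k : hom K X) : Prop :=
  N (f \o k) /\
  forall (K' : C) (k' : hom K' X), N (f \o k') ->
    exists u : hom K' K, k' = k \o u.

Definition has_weak_kernels : Prop :=
  forall (X Y : C) (f : hom X Y),
    exists (K : C) (k : hom K X), is_weak_kernel f k.

Definition is_weak_star (X Y : C) (f1 f2 : hom X Y)
    (K : C) (s1 s2 : hom K Y) : Prop :=
  exists k : hom K X, is_weak_kernel f1 k /\ s1 = f1 \o k /\ s2 = f2 \o k.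

(* The condition ( *pi_0 ).  It is required of all weak stars of (f1, f2);
   as any two weak kernels of f1 factor through each other, it is enough to
   check it on one of them when one exists. *)
Definition star_pi0 (X Y : C) (f1 f2 : hom X Y) : Prop :=
  forall (K : C) (s1 s2 : hom K Y), is_weak_star f1 f2 s1 s2 ->
  forall (Z : C) (g : hom Y Z), g \o s1 = g \o s2 <-> g \o f1 = g \o f2.

Definition is_weak_kernel_pair (X Y : C) (f : hom X Y)
    (P : C) (u v : hom P X) : Prop :=
  f \o u = f \o v /\
  forall (P' : C) (u' v' : hom P' X), f \o u' = f \o v' ->
    exists w : hom P' P, u \o w = u' /\ v \o w = v'.

Definition has_weak_kernel_pairs : Prop :=
  forall (X Y : C) (f : hom X Y),
    exists (P : C) (u v : hom P X), is_weak_kernel_pair f u v.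

Definition is_kernel_pair (X Y : C) (f : hom X Y)
    (P : C) (u v : hom P X) : Prop :=
  f \o u = f \o v /\
  forall (P' : C) (u' v' : hom P' X), f \o u' = f \o v' ->
    exists! w : hom P' P, u \o w = u' /\ v \o w = v'.

Definition has_kernel_pairs : Prop :=
  forall (X Y : C) (f : hom X Y),
    exists (P : C) (u v : hom P X), is_kernel_pair f u v.

Definition is_reflexive_graph (G1 G0 : C)
    (d c : hom G1 G0) (e : hom G0 G1) : Prop :=
  d \o e = idm G0 /\ c \o e = idm G0.

Definition jointly_monic (X Y : C) (d c : hom X Y) : Prop :=
  forall (W : C) (x y : hom W X),
    d \o x = d \o y -> c \o x = c \o y -> x = y.

Definition is_reflexive_relation (G1 G0 : C)
    (d c : hom G1 G0) (e : hom G0 G1) : Prop :=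
  is_reflexive_graph d c e /\ jointly_monic d c.

End Notions.

Arguments has_weak_kernel_pairs C : clear implicits.
Arguments has_kernel_pairs C : clear implicits.

(* Main.v *)
Require Import Defs.

(** Every weak kernel pair is a reflexive graph, and every kernel pair is a
    reflexive relation, so the condition on reflexive graphs is the strongest
    of the four and the condition on (weak) kernel pairs the weakest.  The
    content is the way back, [star_pi0_of_weak_kernel_pair]: a reflexive graph
    [(d, c, e)] inherits the condition from any weak kernel pair [(p, q)] of
    its domain map [d].

    Think of [G1] as a set of arrows, so that [(p, q)] consists of the pairs of
    arrows with a common domain.  Let [g] satisfy [g d k = g c k] for a weak
    kernel [k] of [d], that is, let [g d] and [g c] agree on the arrows with
    null domain.  On a pair of arrows with null first component [p], the common
    domain is null, hence both components are arrows on which [g d] and [g c]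
    agree; as the domains coincide, [g c] takes the same value on both.  The
    condition for [(p, q)], applied to [g c], makes [g c] agree on every pair of
    arrows with a common domain.  The pair formed by the identity on the domain
    of an arrow and the arrow itself, which is [(e d, 1)], then gives
    [g d = g c e d = g c].

    Both the weak and the strict version are covered, because a kernel pair is
    in particular a weak kernel pair. *)

Local Open Scope cat_scope.

Lemma kernel_pair_weak {C : category} {X Y P : C} {f : hom X Y}
    {u v : hom P X} :
  is_kernel_pair f u v -> is_weak_kernel_pair f u v.
Proof.
intros [E U]; split; [exact E|].
intros P' u' v' E'; destruct (U P' u' v' E') as [w [Hw _]].
now exists w.
Qed.

Lemma weak_kernel_pair_reflexive {C : category} {X Y P : C} {f : hom X Y}
    {u v : hom P X} :
  is_weak_kernel_pair f u v -> exists e : hom X P, is_reflexive_graph u v e.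
Proof.
intros [_ U]; destruct (U X (idm X) (idm X) eq_refl) as [e [ue ve]].
now exists e.
Qed.

Lemma kernel_pair_jointly_monic {C : category} {X Y P : C} {f : hom X Y}
    {u v : hom P X} :
  is_kernel_pair f u v -> jointly_monic u v.
Proof.
intros [E U] W x y Eu Ev.
assert (Exx : f \o (u \o x) = f \o (v \o x)) by now rewrite !comp_assoc, E.
destruct (U W _ _ Exx) as [w [_ uniq]].
transitivity w; [symmetry|]; apply uniq; auto.
Qed.

Lemma kernel_pair_reflexive_relation {C : category} {X Y P : C} {f : hom X Y}
    {u v : hom P X} :
  is_kernel_pair f u v -> exists e : hom X P, is_reflexive_relation u v e.
Proof.
intros kp.
destruct (weak_kernel_pair_reflexive (kernel_pair_weak kp)) as [e re].
exists e; split; [exact re | exact (kernel_pair_jointly_monic kp)].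
Qed.

Lemma ideal_comp_r {C : category} {N : morphism_class C} {W X Y : C}
    (f : hom X Y) (h : hom W X) :
  is_ideal N -> N _ _ h -> N _ _ (f \o h).
Proof.
intros I Nh; rewrite <- (comp_idr (f \o h)); now apply I.
Qed.

(** A weak kernel [k] of [f] contains every morphism that [f] makes null, so
    [k] tests the equality of two morphisms on all of these. *)
Lemma weak_kernel_eq {C : category} {N : morphism_class C} {X Y K Z W : C}
    {f : hom X Y} {k : hom K X} {a b : hom X Z} {x : hom W X} :
  is_weak_kernel N f k -> a \o k = b \o k -> N _ _ (f \o x) ->
  a \o x = b \o x.
Proof.
intros [_ U] E Nx; destruct (U W x Nx) as [t ->].
now rewrite !comp_assoc, E.
Qed.

(** The condition for [(d, c)] at [g] is the condition for [(p, q)] at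
    [g \o c]: a pair of arrows with null first component has null domain, and
    the unit [e] places every arrow in a pair with an identity arrow. *)
Lemma star_pi0_of_weak_kernel_pair {C : category} {N : morphism_class C}
    {G1 G0 P : C} {d c : hom G1 G0} {e : hom G0 G1} {p q : hom P G1} :
  is_ideal N -> has_weak_kernels N -> is_reflexive_graph d c e ->
  is_weak_kernel_pair d p q -> star_pi0 N p q -> star_pi0 N d c.
Proof.
intros I wker [de ce] [dpq U] star K s1 s2 [k [kerk [-> ->]]] Z g.
split; intros Eg; [|now rewrite !comp_assoc, Eg].
rewrite !comp_assoc in Eg.
destruct (wker _ _ p) as [L [l kerl]].
assert (Ndp : N _ _ (d \o (p \o l))).
{ apply ideal_comp_r; [exact I | apply kerl]. }
assert (dpql : d \o (p \o l) = d \o (q \o l)) by now rewrite !comp_assoc, dpq.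
assert (Ndq : N _ _ (d \o (q \o l))) by now rewrite <- dpql.
assert (gcl : (g \o c) \o (p \o l) = (g \o c) \o (q \o l)).
{ rewrite <- (weak_kernel_eq kerk Eg Ndp), <- (weak_kernel_eq kerk Eg Ndq).
  now rewrite <- !(comp_assoc g), dpql. }
assert (gc : (g \o c) \o p = (g \o c) \o q).
{ apply (star L (p \o l) (q \o l)); [now exists l | exact gcl]. }
(* The pair of the identity arrow on the domain and the arrow itself. *)
assert (Eed : d \o (e \o d) = d \o idm G1).
{ now rewrite comp_assoc, de, comp_idl, comp_idr. }
destruct (U _ _ _ Eed) as [w [pw qw]].
transitivity ((g \o c) \o (e \o d)).
- now rewrite <- comp_assoc, (comp_assoc c), ce, comp_idl.
- now rewrite <- pw, comp_assoc, gc, <- comp_assoc, qw, comp_idr.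
Qed.

Theorem theorem2p2 (C : category) (N : morphism_class C)
    (N_ideal : is_ideal N)
    (wker : has_weak_kernels N)
    (wkp : has_weak_kernel_pairs C) :
  let cond_a := forall (G1 G0 : C) (d c : hom G1 G0) (e : hom G0 G1),
    is_reflexive_graph d c e -> star_pi0 N d c in
  let cond_b := forall (X Y : C) (f : hom X Y) (P : C) (u v : hom P X),
    is_weak_kernel_pair f u v -> star_pi0 N u v in
  let cond_c := forall (G1 G0 : C) (d c : hom G1 G0) (e : hom G0 G1),
    is_reflexive_relation d c e -> star_pi0 N d c in
  let cond_d := forall (X Y : C) (f : hom X Y) (P : C) (u v : hom P X),
    is_kernel_pair f u v -> star_pi0 N u v in
  (cond_a <-> cond_b) /\
  (has_kernel_pairs C -> (cond_a <-> cond_c) /\ (cond_a <-> cond_d)).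
Proof.
intros cond_a cond_b cond_c cond_d.
assert (ab : cond_a -> cond_b).
{ intros A X Y f P u v kp.
  destruct (weak_kernel_pair_reflexive kp) as [e re]; exact (A _ _ _ _ _ re). }
assert (ba : cond_b -> cond_a).
{ intros B G1 G0 d c e re; destruct (wkp _ _ d) as [P [p [q kp]]].
  exact (star_pi0_of_weak_kernel_pair N_ideal wker re kp (B _ _ _ _ _ _ kp)). }
assert (ac : cond_a -> cond_c).
{ intros A G1 G0 d c e [re _]; exact (A _ _ _ _ _ re). }
assert (cd : cond_c -> cond_d).
{ intros H X Y f P u v kp.
  destruct (kernel_pair_reflexive_relation kp) as [e re].
  exact (H _ _ _ _ _ re). }
split; [now split|].
intros kps.
assert (da : cond_d -> cond_a).
{ intros D G1 G0 d c e re; destruct (kps _ _ d) as [P [p [q kp]]].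
  exact (star_pi0_of_weak_kernel_pair N_ideal wker re (kernel_pair_weak kp)
           (D _ _ _ _ _ _ kp)). }
split; split; auto.
Qed.
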